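(* Let $f: 2^X \to \mathbb{R}_{\ge 0}$ be any (not necessarily monotone) non-negative submodular function with $f(\emptyset)=0$ on a finite ground set $X$, let $\mathbf{p}=(p_e)_{e\in X}$ be any activation probabilities, and let $\mathcal{F}$ be any prefix-closed probing constraint. Then the adaptivity gap of the stochastic probing problem $(X,\mathbf{p},f,\mathcal{F})$ is at most $40$.
   Context: Stochastic probing problem: a finite ground set $X$; each element $e\in X$ is active independently with known probability $p_e$; its status is revealed only when $e$ is probed. A probing constraint $\mathcal{F}$ is a family of sequences of distinct elements of $X$; it is prefix-closed if every prefix of a sequence in $\mathcal{F}$ is in $\mathcal{F}$. An adaptive strategy is a binary decision tree whose internal nodes are labelled by elements (yes-arc taken if the element is active, no-arc otherwise), no element repeats on a root-leaf path, and every root-leaf path's element sequence belongs to $\mathcal{F}$; on reaching a leaf with set $A$ of observed active elements, it receives $f^{\max}(A):=\max_{T\subseteq A} f(T)$. A non-adaptive strategy is a fixed sequence $\sigma\in\mathcal{F}$; its value is $\mathbb{E}[f^{\max}(A\cap\sigma)]$ with $A$ the random set of active elements. The adaptivity gap is the ratio of the best expected adaptive value to the best expected non-adaptive value. *)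

(* Defs.v *)
From mathcomp Require Import all_boot all_order all_algebra.
From mathcomp Require Import boolp classical_sets reals constructive_ereal.

Set Implicit Arguments.
Unset Strict Implicit.
Unset Printing Implicit Defensive.
Import Order.TTheory GRing.Theory Num.Theory.
Local Open Scope ring_scope.
Local Open Scope classical_set_scope.

Section SetFunctions.
Variables (R : realType) (X : finType).
Implicit Types (f : {set X} -> R) (A B : {set X}).

Definition submodular f : Prop :=
  forall A B, f (A :|: B)%SET + f (A :&: B)%SET <= f A + f B.

(* The default value [f set0] is harmless: the empty set is one of the T. *)
Definition fmax f A : R :=
  \big[Num.max/f finset.set0]_(T : {set X} | T \subset A) f T.

End SetFunctions.

Section ActiveSet.
Variables (R : realType) (X : finType) (p : X -> R).

(* Law of the random active set when the elements e are active independently,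
   each with probability [p e]. *)
Definition active_prob (A : {set X}) : R :=
  (\prod_(e in A) p e) * (\prod_(e in ~: A) (1 - p e)).

Definition expect (g : {set X} -> R) : R :=
  \sum_(A : {set X}) active_prob A * g A.

End ActiveSet.

Section Constraints.
Variable X : finType.
Implicit Type F : set (seq X).

Definition probing_constraint F : Prop := forall s, F s -> uniq s.

Definition prefix_closed F : Prop := forall s t, prefix s t -> F t -> F s.

End Constraints.

Section Strategies.
Variable X : finType.

(* [Node e tyes tno] probes e, then follows [tyes] if e is active and [tno]
   otherwise. *)
Inductive dtree : Type :=
| Leaf
| Node of X & dtree & dtree.

Fixpoint paths (t : dtree) : seq (seq X) :=
  if t is Node e tyes tno then [seq e :: s | s <- paths tyes ++ paths tno]
  else [:: [::]].

Definition adaptive_strategy (F : set (seq X)) (t : dtree) : Prop :=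
  forall s, s \in paths t -> uniq s /\ F s.

(* The active elements observed on the root-leaf path followed when the set
   of active elements is A. *)
Fixpoint observed (t : dtree) (A : {set X}) : {set X} :=
  if t is Node e tyes tno then
    if e \in A then (e |: observed tyes A)%SET else observed tno A
  else finset.set0.

End Strategies.
Arguments Leaf {X}.

Section Gap.
Variables (R : realType) (X : finType).
Variables (p : X -> R) (f : {set X} -> R) (F : set (seq X)).

Definition adaptive_value (t : dtree X) : R :=
  expect p (fun A => fmax f (observed t A)).

Definition nonadaptive_value (s : seq X) : R :=
  expect p (fun A => fmax f (A :&: [set e in s])%SET).

Definition adaptive_values : set R :=
  [set adaptive_value t | t in [set t | adaptive_strategy F t]].

Definition nonadaptive_values : set R :=
  [set nonadaptive_value s | s in F].

(* These suprema are genuine as soon as F is a nonempty prefix-closed family: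
   see [has_sup_adaptive_values] and [has_sup_nonadaptive_values]. *)
Definition best_adaptive : R := sup adaptive_values.
Definition best_nonadaptive : R := sup nonadaptive_values.

(* Division in the extended reals, where r / 0 = +oo for r > 0 and 0 / 0 = 0:
   the gap is infinite if only the adaptive optimum is positive. *)
Definition adaptivity_gap : \bar R :=
  (best_adaptive%:E / best_nonadaptive%:E)%E.

Hypothesis p01 : forall e, 0 <= p e <= 1.

Lemma active_prob_ge0 A : 0 <= active_prob p A.
Proof.
apply: mulr_ge0; apply: prodr_ge0 => e _; have /andP[p0 p1] := p01 e => //.
by rewrite subr_ge0.
Qed.

Lemma fmax_le_setT (A : {set X}) : fmax f A <= fmax f [set: X]%SET.
Proof.
by apply: sub_bigmax => T _; rewrite finset.subsetT.
Qed.

Lemma expect_fmax_le (o : {set X} -> {set X}) :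
  expect p (fun A => fmax f (o A)) <= expect p (fun=> fmax f [set: X]%SET).
Proof.
by apply: ler_sum => A _; rewrite ler_wpM2l ?active_prob_ge0 ?fmax_le_setT.
Qed.

Hypotheses (F_prefix : prefix_closed F) (F_neq0 : F !=set0).

Lemma has_sup_adaptive_values : has_sup adaptive_values.
Proof.
split; last first.
  by exists (expect p (fun=> fmax f [set: X]%SET)) => _ [t _ <-]; exact: expect_fmax_le.
exists (adaptive_value Leaf); exists Leaf => // s /=.
rewrite inE => /eqP ->; split=> //.
by case: F_neq0 => t; apply: F_prefix; rewrite prefix0s.
Qed.

Lemma has_sup_nonadaptive_values : has_sup nonadaptive_values.
Proof.
split; last first.
  by exists (expect p (fun=> fmax f [set: X]%SET)) => _ [s _ <-]; exact: expect_fmax_le.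
by case: F_neq0 => s Fs; exists (nonadaptive_value s); exists s.
Qed.

End Gap.

(* Main.v *)
Require Import Defs.
From mathcomp Require Import all_boot all_order all_algebra.
From mathcomp Require Import boolp classical_sets reals constructive_ereal.
From mathcomp Require Import fintype finset ring lra.

(** Walk down the adaptive tree and let [A] be the set of active elements it
    observes. Independently resample the statuses along the walked path, and
    build [R] online: a resampled active element is added to [R], with
    probability [q], if it strictly increases [f R]. Let [C] be the subset of
    [A] maximizing [f].

    - [R] contains each element with probability at most [q], so
      [E f(C :|: R) >= (1 - q) f(C)].
    - By submodularity, [f(C :|: R) <= f(R) + sum of the positive parts of the
      marginals f(e | R_before_e)] over the [e] in [A]. Given the past, [e] has
      the same probability of being active in the walk and in the resampling,
      so the expectation of this sum is [E f(R) / q].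

    Hence [q (1 - q)] times the adaptive value is at most [(1 + q) E f(R)],
    where [R] is a set of active elements on a path of the tree, i.e. on a
    feasible nonadaptive sequence. For [q = 1/2] the gap is at most [6]. *)

Set Implicit Arguments.
Unset Strict Implicit.
Unset Printing Implicit Defensive.
Import Order.TTheory GRing.Theory Num.Theory.
Local Open Scope ring_scope.

(** * Independent activation and conditioning on one element *)

Section Expect.
Variables (R : realType) (X : finType) (p : X -> R).
Implicit Types (A B : {set X}) (g : {set X} -> R) (e : X).

Lemma sum_active_prob : \sum_A active_prob p A = 1.
Proof.
have : \prod_e (p e + (1 - p e)) = _ := bigA_distr _ _ _ _.
rewrite (eq_bigr (fun=> 1)) ?big1_eq; last by move=> e _; rewrite addrC subrK.
move=> ->; apply: eq_bigr => A _.
rewrite /active_prob [RHS](bigID [pred e | e \in A]) /=; congr (_ * _).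
  by apply: eq_bigr => e ->.
apply: eq_big => e; rewrite ?inE //.
by move=> /negPf ->.
Qed.

Lemma expect_cst (c : R) : expect p (fun=> c) = c.
Proof. by rewrite /expect -mulr_suml sum_active_prob mul1r. Qed.

Lemma le_expect g1 g2 : (forall e, 0 <= p e <= 1) ->
  (forall A, g1 A <= g2 A) -> expect p g1 <= expect p g2.
Proof.
by move=> p01 le12; apply: ler_sum => A _; rewrite ler_wpM2l ?active_prob_ge0.
Qed.

Lemma expect_condition e g :
  expect p g = p e * expect p (fun A => g (e |: A))
             + (1 - p e) * expect p (fun A => g (A :\ e)).
Proof.
(* For [e \notin A], [w A] is the probability that the active set agrees with [A] outside [e]. *)
pose w A := (\prod_(x in A) p x) * \prod_(x in ~: A :\ e) (1 - p x).
have probU A : e \notin A -> active_prob p (e |: A) = p e * w A.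
  move=> eA; rewrite /active_prob big_setU1 //= mulrA; congr (_ * _).
  by apply: eq_bigl => x; rewrite !inE negb_or.
have probD A : e \notin A -> active_prob p A = (1 - p e) * w A.
  move=> eA; rewrite /active_prob [X in _ * X](big_setD1 e) ?inE //=.
  by rewrite mulrCA.
have split h : expect p h =
    \sum_(A : {set X} | e \notin A) w A * (p e * h (e |: A) + (1 - p e) * h A).
  rewrite /expect (bigID (fun A : {set X} => e \in A)) /=.
  rewrite (reindex_onto (fun A => e |: A) (fun A => A :\ e)) /=; last first.
    by move=> A eA; rewrite setD1K.
  rewrite (eq_bigl (fun A : {set X} => e \notin A)); last first.
    move=> A; rewrite setU11 /=; apply/eqP/idP => [<-|eA].
      by rewrite setD11.
    by rewrite setU1K.
  rewrite -big_split /=; apply: eq_bigr => A eA.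
  by rewrite probU // probD //; ring.
rewrite !split !mulr_sumr -big_split /=; apply: eq_bigr => A eA.
rewrite setUA setUid setU1K //.
have -> : A :\ e = A by apply/setDidPl; rewrite disjoint_sym disjoints1.
by ring.
Qed.

End Expect.

Section Fmax.
Variables (R : realType) (X : finType) (f : {set X} -> R).
Implicit Types (A B T : {set X}).

Lemma fmax_attained A : exists2 T : {set X}, T \subset A & fmax f A = f T.
Proof.
apply: (big_ind (fun x => exists2 T : {set X}, T \subset A & x = f T)) =>
  [|x y [T TA ->] [U UA ->]|T TA].
- by exists set0; rewrite // sub0set.
- by case: (leP (f T) (f U)) => _; [exists U | exists T].
- by exists T.
Qed.

Lemma le_fmax T A : T \subset A -> f T <= fmax f A.
Proof. by move=> TA; apply: (@le_bigmax_cond _ _ _ _ T _ f). Qed.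

Lemma fmax_mono A B : A \subset B -> fmax f A <= fmax f B.
Proof.
move=> AB; have [T TA ->] := fmax_attained A.
exact: le_fmax (subset_trans TA AB).
Qed.

End Fmax.

(** * The law of the walk down a decision tree *)

Section Outcomes.
Variables (R : realType) (X : finType) (p : X -> R).
Implicit Types (t : dtree X) (o : seq (X * bool)) (phi psi : seq (X * bool) -> R).

(** Statuses are drawn node by node instead of from one global active set, which makes induction on
    [t] available. *)
Fixpoint outcome_expect t phi : R :=
  if t is Node e tyes tno then
    p e * outcome_expect tyes (fun o => phi ((e, true) :: o))
    + (1 - p e) * outcome_expect tno (fun o => phi ((e, false) :: o))
  else phi [::].

Fixpoint hits o : {set X} :=
  if o is (e, b) :: o' then if b then e |: hits o' else hits o'
  else set0.

Lemma outcome_expect_cst t (c : R) : outcome_expect t (fun=> c) = c.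
Proof. by elim: t => [|e y IHy n IHn] //=; rewrite IHy IHn; ring. Qed.

Lemma outcome_expectD t phi psi :
  outcome_expect t (fun o => phi o + psi o)
  = outcome_expect t phi + outcome_expect t psi.
Proof.
by elim: t phi psi => [|e y IHy n IHn] phi psi //=; rewrite IHy IHn; ring.
Qed.

Lemma outcome_expectZ t (c : R) phi :
  outcome_expect t (fun o => c * phi o) = c * outcome_expect t phi.
Proof.
by elim: t phi => [|e y IHy n IHn] phi //=; rewrite IHy IHn; ring.
Qed.

Lemma le_outcome_expect t phi psi : (forall e, 0 <= p e <= 1) ->
  (forall o, unzip1 o \in paths t -> phi o <= psi o) ->
  outcome_expect t phi <= outcome_expect t psi.
Proof.
move=> p01; elim: t phi psi => [|e y IHy n IHn] phi psi le_pp /=.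
  by apply: le_pp; rewrite inE.
have /andP[p0 p1] := p01 e.
apply: lerD; apply: ler_wpM2l; rewrite ?subr_ge0 //.
  by apply: IHy => o oy; apply/le_pp/map_f; rewrite mem_cat oy.
by apply: IHn => o on; apply/le_pp/map_f; rewrite mem_cat on orbT.
Qed.

Lemma observed_ext t (e : X) (A B : {set X}) :
  (forall s, s \in paths t -> e \notin s) -> A :\ e = B :\ e ->
  observed t A = observed t B.
Proof.
move=> + eqAB; elim: t => [|x y IHy n IHn] //= e_t.
have memt s : s \in paths y ++ paths n -> e \notin x :: s.
  by move=> sP; apply/e_t/map_f.
have [s sn] : exists s, s \in paths n.
  elim: (n) => [|z y' _ n' [s sn]]; first by exists [::]; rewrite inE.
  by exists (z :: s); apply: map_f; rewrite mem_cat sn orbT.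
have ne_xe : x != e.
  have /memt : s \in paths y ++ paths n by rewrite mem_cat sn orbT.
  by rewrite inE negb_or eq_sym => /andP[].
have -> : (x \in A) = (x \in B) by move/setP/(_ x): eqAB; rewrite !inE ne_xe.
rewrite IHy ?IHn // => r r_in.
  have /memt : r \in paths y ++ paths n by rewrite mem_cat r_in orbT.
  by rewrite inE negb_or => /andP[].
have /memt : r \in paths y ++ paths n by rewrite mem_cat r_in.
by rewrite inE negb_or => /andP[].
Qed.

(** No element repeats on a path, so what is observed below a node is independent of the status at
    that node. *)
Lemma expect_observed t (g : {set X} -> R) :
  (forall s, s \in paths t -> uniq s) ->
  expect p (fun A => g (observed t A)) = outcome_expect t (fun o => g (hits o)).
Proof.
elim: t g => [|e y IHy n IHn] g uniq_t; first exact: (expect_cst p (g set0)).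
have uniqP s : s \in paths y ++ paths n -> uniq (e :: s).
  by move=> sP; apply/uniq_t/map_f.
have uniqy s : s \in paths y -> (e \notin s) && uniq s.
  by move=> sy; apply: uniqP; rewrite mem_cat sy.
have uniqn s : s \in paths n -> (e \notin s) && uniq s.
  by move=> sn; apply: uniqP; rewrite mem_cat sn orbT.
rewrite (expect_condition _ e) /=.
rewrite -(IHy (fun B => g (e |: B))); last by move=> s /uniqy/andP[].
rewrite -IHn; last by move=> s /uniqn/andP[].
congr (_ * _ + _ * _); apply: eq_bigr => A _; congr (_ * g _).
  rewrite setU11 (@observed_ext y e (e |: A) A) //.
    by move=> s /uniqy/andP[].
  by rewrite setDUl setDv set0U.
rewrite setD11 (@observed_ext n e (A :\ e) A) //.
  by move=> s /uniqn/andP[].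
by rewrite setDDl setUid.
Qed.

End Outcomes.

(** * The randomized greedy process and its bounds *)

Section Greedy.
Variables (R : realType) (X : finType) (p : X -> R) (f : {set X} -> R) (q : R).
Hypotheses (p01 : forall e, 0 <= p e <= 1) (q01 : 0 <= q <= 1).
Hypotheses (f_ge0 : forall A, 0 <= f A) (f_submod : submodular f).
Implicit Types (e : X) (s : seq X) (S G C : {set X}) (o : seq (X * bool)).

Lemma submodular_marginal S G e : S \subset G -> e \notin G ->
  f (e |: G) + f S <= f (e |: S) + f G.
Proof.
move=> SG eG; have := f_submod (e |: S) G.
rewrite -setUA (setUidPr SG) setIUl (setIidPl SG).
by have /eqP -> : [set e] :&: G == set0; rewrite ?set0U // setI_eq0 disjoints1.
Qed.

Definition gain S e : R := Num.max 0 (f (e |: S) - f S).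

Lemma gain_ge0 S e : 0 <= gain S e.
Proof. by rewrite /gain le_max lexx. Qed.

Lemma le_gain S e : f (e |: S) - f S <= gain S e.
Proof. by rewrite /gain le_max lexx orbT. Qed.

Lemma gain_anti S G e : S \subset G -> gain G e <= gain S e.
Proof.
move=> SG; rewrite {1}/gain ge_max gain_ge0 /=.
have [eG|eG] := boolP (e \in G).
  by rewrite (setUidPr _) ?sub1set // subrr gain_ge0.
apply: le_trans (le_gain S e).
by have := submodular_marginal SG eG; lra.
Qed.

(* [S] is the set picked so far by the greedy process; [greedy s S G] is the
   expectation of [f (G :|: N)], where [N] is the set of the elements newly
   picked while scanning [s]. *)
Fixpoint greedy s S G : R :=
  if s is e :: s' then
    if f S < f (e |: S) then
      p e * q * greedy s' (e |: S) (e |: G) + (1 - p e * q) * greedy s' S G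
    else greedy s' S G
  else f G.

(* As [greedy], but [N] consists of all the active elements that increase the
   current value of [f], including those that lose the [q]-biased coin toss and
   are not picked. *)
Fixpoint greedy_candidates s S G : R :=
  if s is e :: s' then
    if f S < f (e |: S) then
      p e * (q * greedy_candidates s' (e |: S) (e |: G)
             + (1 - q) * greedy_candidates s' S (e |: G))
      + (1 - p e) * greedy_candidates s' S G
    else greedy_candidates s' S G
  else f G.

(* The expected sum, over the active elements of [o], of the gains with respect
   to the set picked so far. *)
Fixpoint greedy_gains o S : R :=
  if o is (e, b) :: o' then
    (if b then gain S e else 0)
    + (if f S < f (e |: S) then
         p e * q * greedy_gains o' (e |: S) + (1 - p e * q) * greedy_gains o' S
       else greedy_gains o' S)
  else 0.

Lemma pick_prob01 e : 0 <= p e * q <= 1.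
Proof.
have /andP[p0 p1] := p01 e; have /andP[q0 q1] := q01.
by rewrite mulr_ge0 // mulr_ile1.
Qed.

Lemma ler_conv (a x1 x2 y1 y2 : R) : 0 <= a <= 1 -> x1 <= y1 -> x2 <= y2 ->
  a * x1 + (1 - a) * x2 <= a * y1 + (1 - a) * y2.
Proof.
by move=> /andP[a0 a1] le1 le2; apply: lerD; apply: ler_wpM2l; rewrite ?subr_ge0.
Qed.

Lemma greedy_candidates_ge0 s S G : 0 <= greedy_candidates s S G.
Proof.
elim: s S G => [|e s IH] S G //=; case: ifP => // _.
have /andP[p0 p1] := p01 e; have /andP[q0 q1] := q01.
apply: addr_ge0; apply: mulr_ge0; rewrite ?subr_ge0 //.
by apply: addr_ge0; apply: mulr_ge0; rewrite ?subr_ge0.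
Qed.

(** The candidates depend on [s] and [S] only and avoid [e]; adding them can only shrink the
    marginal of [e]. *)
Lemma greedy_candidates_marginal s S G e : e \notin s -> e \notin G ->
  greedy_candidates s S (e |: G) + f G <= greedy_candidates s S G + f (e |: G).
Proof.
have /andP[q0 q1] := q01.
(* The bound keeps [G] fixed while [H'] absorbs the candidates during the induction. *)
suff H (H' : {set X}) : G \subset H' -> e \notin s -> e \notin H' ->
    greedy_candidates s S (e |: H') + f G <= greedy_candidates s S H' + f (e |: G).
  exact: H.
elim: s S H' => [|x s IH] S H GH /= es eH.
  by have := submodular_marginal GH eH; lra.
move: es; rewrite inE negb_or => /andP[ne_ex es].
have /andP[p0 p1] := p01 x.
have IHx S' : greedy_candidates s S' (x |: (e |: H)) - greedy_candidates s S' (x |: H)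
    <= f (e |: G) - f G.
  rewrite setUCA; have := IH S' (x |: H) (subset_trans GH (subsetUr _ _)) es.
  by rewrite !inE negb_or ne_ex eH => /(_ isT); lra.
have IH0 : greedy_candidates s S (e |: H) - greedy_candidates s S H
    <= f (e |: G) - f G by have := IH S H GH es eH; lra.
case: ifP => _; last lra.
have := ler_conv (p01 x) (ler_conv q01 (IHx (x |: S)) (IHx S)) IH0.
lra.
Qed.

(* If picking [e] leads to the candidates [D1] and not picking it to [D0], then
   [f(e) + f(D0) >= f(e :|: D0) + f(set0)] absorbs the cross terms. *)
Lemma greedy_lower s S G : uniq s ->
  (1 - q) * f G + q * greedy_candidates s S G <= greedy s S G.
Proof.
have /andP[q0 q1] := q01.
elim: s S G => [|e s IH] S G /=; first by move=> _; lra.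
move=> /andP[es us]; case: ifP => _; last exact: IH.
have marg : greedy_candidates s S (e |: G) + f G
    <= greedy_candidates s S G + f (e |: G).
  have [eG|eG] := boolP (e \in G); last exact: greedy_candidates_marginal.
  by rewrite (setUidPr _) ?sub1set.
have := ler_conv (pick_prob01 e) (IH (e |: S) (e |: G) us) (IH S G us).
have /andP[p0 p1] := p01 e.
(* Once the induction hypotheses are used, the terms where [e] is picked cancel and the slack is
   exactly this factor times that of [marg]. *)
have : 0 <= p e * q * (1 - q) by rewrite !mulr_ge0 ?subr_ge0.
move: marg; rewrite -subr_ge0 => marg /mulr_ge0/(_ marg).
lra.
Qed.

Lemma greedy_ge s S G : uniq s -> (1 - q) * f G <= greedy s S G.
Proof.
move=> us; apply: le_trans (greedy_lower S G us).
by rewrite lerDl mulr_ge0 ?greedy_candidates_ge0 //; case/andP: q01.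
Qed.

(** Every set averaged by [greedy] contains [S], so diminishing returns apply. *)
Lemma greedy_marginal s S G e : S \subset G ->
  greedy s S (e |: G) <= greedy s S G + gain S e.
Proof.
elim: s S G => [|x s IH] S G SG /=.
  by have := le_gain G e; have := gain_anti e SG; lra.
case: ifP => _; last exact: IH.
have IHx : greedy s (x |: S) (x |: (e |: G))
    <= greedy s (x |: S) (x |: G) + gain S e.
  rewrite setUCA; apply: le_trans (IH _ _ (setUS _ SG)) _.
  by rewrite lerD2l gain_anti // subsetUr.
by have := ler_conv (pick_prob01 x) IHx (IH S G SG); lra.
Qed.

(** Elements of [C] outside [S] are still to be scanned. When its turn comes, such an element is
    either picked, at no cost, or removed from [C] at the price of its gain over the current picked
    set. *)
Lemma greedy_upper o S C : C \subset S :|: hits o ->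
  greedy (unzip1 o) S (C :|: S) <= greedy (unzip1 o) S S + greedy_gains o S.
Proof.
elim: o S C => [|[e b] o IH] S C /=.
  by rewrite setU0 => /setUidPr ->; rewrite addr0.
move=> CS.
have gb : 0 <= (if b then gain S e else 0) by case: (b); rewrite ?gain_ge0.
have pick : greedy (unzip1 o) (e |: S) (e |: (C :|: S)) <=
    greedy (unzip1 o) (e |: S) (e |: S) + greedy_gains o (e |: S).
  rewrite setUCA; apply: IH; apply: (subset_trans CS).
  by case: (b); rewrite ?setUA ?(setUC [set e]) // -setUA setUS // subsetUr.
have skip : greedy (unzip1 o) S (C :|: S) <=
    greedy (unzip1 o) S S + greedy_gains o S + (if b then gain S e else 0).
  case: (b) CS => CS; last by rewrite addr0 IH.
  have CeS : C :\ e \subset S :|: hits o.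
    by rewrite subDset setUCA.
  have [eC|eC] := boolP (e \in C).
    rewrite -(setD1K eC) -setUA.
    apply: le_trans (greedy_marginal _ _ (subsetUr _ _)) _.
    by rewrite lerD2r IH.
  have <- : C :\ e = C by apply/setDidPl; rewrite disjoint_sym disjoints1.
  by apply: le_trans (IH _ _ CeS) _; rewrite lerDl gain_ge0.
case: ifP => _; last by lra.
have /andP[a0 a1] := pick_prob01 e.
have := ler_conv (pick_prob01 e) pick skip.
have := mulr_ge0 a0 gb.
lra.
Qed.

Lemma greedy_gains_ge o : uniq (unzip1 o) ->
  (1 - q) * fmax f (hits o) <=
    greedy (unzip1 o) set0 set0 + greedy_gains o set0.
Proof.
move=> us; have [C Co ->] := fmax_attained f (hits o).
have Co0 : C \subset set0 :|: hits o by rewrite set0U.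
apply: le_trans (greedy_upper Co0).
by rewrite setU0; apply: greedy_ge.
Qed.

(** At each node the sum of gains grows by [p e * gain S e] on average, and the value of the picked
    set by [q] times as much; the latter telescopes from [f S]. *)
Lemma outcome_expect_gains t S :
  q * outcome_expect p t (fun o => greedy_gains o S) =
  outcome_expect p t (fun o => greedy (unzip1 o) S S) - f S.
Proof.
elim: t S => [|e y IHy n IHn] S /=; first by rewrite mulr0 subrr.
have Ey T := canLR (addrNK _) (IHy T); have En T := canLR (addrNK _) (IHn T).
rewrite /gain; case: ltP => [lt_fS|le_fS].
  rewrite !(outcome_expectD, outcome_expectZ, outcome_expect_cst) -!Ey -!En.
  by rewrite max_r ?subr_ge0 ?ltW //; ring.
rewrite !(outcome_expectD, outcome_expectZ, outcome_expect_cst) -Ey -En.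
by rewrite max_l ?subr_le0 //; ring.
Qed.

(** The picked elements can be coupled to lie among the active elements of [s]. *)
Lemma greedy_le_expect s S : uniq s ->
  greedy s S S <= expect p (fun A => fmax f (S :|: (A :&: [set e in s]))).
Proof.
elim: s S => [|e s IH] S /=.
  by move=> _; rewrite -[f S](expect_cst p) le_expect // => A; rewrite le_fmax ?subsetUl.
move=> /andP[es us]; rewrite (expect_condition p e).
set E1 := expect _ _; set E0 := expect _ _.
have le0 : greedy s S S <= E0.
  apply: le_trans (IH S us) (le_expect p01 _) => A.
  apply/fmax_mono/setUS/subsetP => x; rewrite !inE => /andP[-> xs].
  by rewrite xs orbT !andbT; apply: contraNneq es => <-.
have le1 S' : S' \subset e |: S -> greedy s S' S' <= E1.
  move=> S'S; apply: le_trans (IH S' us) (le_expect p01 _) => A.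
  apply/fmax_mono/subsetP => x; rewrite !inE => /orP[/(subsetP S'S)|/andP[-> ->]].
    by rewrite !inE => /orP[] ->; rewrite ?orbT.
  by rewrite !orbT.
have le10 := le1 S (subsetUr _ _); have le11 := le1 _ (subxx (e |: S)).
(* The probability [p e * q] splits into the status of [e] followed by the coin toss; [E1] dominates
   both results of the toss. *)
have := ler_conv (p01 e) (ler_conv q01 le11 le10) le0.
have := ler_conv (p01 e) le10 le0.
case: ifP => _; lra.
Qed.

Lemma adaptive_le_greedy t : f set0 = 0 ->
  (forall s, s \in paths t -> uniq s) ->
  q * (1 - q) * adaptive_value p f t <=
  (1 + q) * outcome_expect p t (fun o => greedy (unzip1 o) set0 set0).
Proof.
move=> f0 uniq_t; rewrite /adaptive_value (expect_observed p (fmax f) uniq_t).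
have : (1 - q) * outcome_expect p t (fun o => fmax f (hits o)) <=
    outcome_expect p t (fun o => greedy (unzip1 o) set0 set0)
    + outcome_expect p t (fun o => greedy_gains o set0).
  rewrite -outcome_expectZ -outcome_expectD.
  apply: le_outcome_expect => // o /uniq_t; exact: greedy_gains_ge.
(* Scaling by [q] turns the gains term into a second copy of the greedy term, weighted by [q]. *)
have /andP[q0 _] := q01; move=> /(ler_wpM2l q0).
by rewrite mulrDr outcome_expect_gains f0; lra.
Qed.

End Greedy.

(** * From the greedy bound to the adaptivity gap *)

Lemma adaptive_le_paths (R : realType) (X : finType) (p : X -> R)
    (f : {set X} -> R) (t : dtree X) (M : R) :
  (forall e, 0 <= p e <= 1) -> (forall A, 0 <= f A) -> submodular f ->
  f set0 = 0 ->
  (forall s, s \in paths t -> uniq s /\ nonadaptive_value p f s <= M) ->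
  adaptive_value p f t <= 6 * M.
Proof.
move=> p01 f_ge0 f_submod f0 path_t.
(* At this [q] the ratio [(1 + q) / (q * (1 - q))] equals 6. *)
have q01 : 0 <= (2^-1 : R) <= 1 by lra.
have := adaptive_le_greedy p01 q01 f_ge0 f_submod f0 (fun s st => (path_t s st).1).
suff : outcome_expect p t
    (fun o => greedy p f 2^-1 (unzip1 o) set0 set0) <= M by lra.
rewrite -[M](outcome_expect_cst p t); apply: le_outcome_expect => // o ot.
have [us le_M] := path_t _ ot.
apply: le_trans (greedy_le_expect f p01 q01 _ us) (le_trans _ le_M).
by apply: le_expect => // A; rewrite set0U.
Qed.

Theorem theorem2 (R : realType) (X : finType) (p : X -> R)
    (f : {set X} -> R) (F : set (seq X))
    (p01 : forall e, (0 <= p e <= 1)%R)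
    (f_ge0 : forall A, (0 <= f A)%R)
    (f_submod : submodular f)
    (f_set0 : f finset.set0 = 0%R)
    (F_distinct : probing_constraint F)
    (F_prefix : prefix_closed F) :
  (adaptivity_gap p f F <= 40%:E)%E.
Proof.
have fmax_ge0 (A : {set X}) : 0 <= fmax f A.
  by apply: le_trans (f_ge0 finset.set0) (le_fmax _ _); rewrite sub0set.
have expect_ge0 (o : {set X} -> {set X}) : 0 <= expect p (fun A => fmax f (o A)).
  by rewrite -[0](expect_cst p); apply: le_expect.
have sup_ge0 (E : set R) : (forall x, E x -> 0 <= x) -> 0 <= sup E.
  move=> E0; have [[[x Ex] ubE]|nsup] := pselect (has_sup E); last by rewrite sup_out.
  exact: le_trans (E0 _ Ex) (ub_le_sup ubE Ex).
have na_ge0 : 0 <= best_nonadaptive p f F.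
  by apply: sup_ge0 => _ [s _ <-]; apply: expect_ge0.
have a_ge0 : 0 <= best_adaptive p f F.
  by apply: sup_ge0 => _ [t _ <-]; apply: expect_ge0.
have a_le : best_adaptive p f F <= 6 * best_nonadaptive p f F.
  rewrite {1}/best_adaptive.
  (* Without any strategy, as when [F] is empty, [sup] takes its default value 0. *)
  have [[t0 t0P]|no_t] := pselect (exists t, adaptive_strategy F t); last first.
    rewrite sup_out ?mulr_ge0 // => -[[_ [t tP _]] _].
    by apply: no_t; exists t.
  apply: ge_sup; first by exists (adaptive_value p f t0); exists t0.
  move=> _ [t tP <-]; apply: adaptive_le_paths => // s st.
  have [us Fs] := tP _ st; split=> //.
  have F_neq0 : classical_sets.nonempty F by exists s.
  have [_ ubF] := has_sup_nonadaptive_values f p01 F_neq0.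
  by apply: (ub_le_sup ubF); exists s.
rewrite /adaptivity_gap.
(* A zero denominator forces a zero numerator, and the extended quotient is then 0. *)
have [na0|na_neq0] := eqVneq (best_nonadaptive p f F) 0.
  have -> : best_adaptive p f F = 0 by apply/le_anti; rewrite a_ge0 andbT; lra.
  by rewrite mul0e lee_fin.
rewrite inver (negPf na_neq0) -EFinM lee_fin ler_pdivrMr; last by rewrite lt0r na_neq0.
by lra.
Qed.
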